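(* Let $d\in\mathbb{N}$ and let $\mathcal{F}_1,\dots,\mathcal{F}_{3d}$ be non-empty collections of axis-parallel boxes in $\mathbb{R}^d$ such that every colorful $3d$-tuple is $2$-pierceable. Then there exist $i\in[3d]$ and, for every $k\in[3d]$ with $k\neq i$, a box $F_k\in\mathcal{F}_k$ such that $\mathcal{F}_i\cup\{F_k: k\in[3d],\,k\neq i\}$ is $2$-pierceable.
   Context: An axis-parallel box in $\mathbb{R}^d$ is a set $[\alpha_1,\beta_1]\times\dots\times[\alpha_d,\beta_d]$ with $\alpha_j\le\beta_j$. A family is $2$-pierceable if some set of at most $2$ points meets every member. A colorful $3d$-tuple from $\mathcal{F}_1,\dots,\mathcal{F}_{3d}$ is a tuple $(C_1,\dots,C_{3d})$ with $C_j\in\mathcal{F}_{i_j}$ for pairwise distinct indices $i_j$ (one member from each family). *)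

(* Defs.v *)
From mathcomp Require Import all_boot.
From Stdlib Require Import Reals.
Set Implicit Arguments. Unset Strict Implicit. Unset Printing Implicit Defensive.

Open Scope R_scope.

Definition point (d : nat) := 'I_d -> R.

Record box (d : nat) := Box {
  lo : 'I_d -> R;
  hi : 'I_d -> R;
  lo_le_hi : forall j, lo j <= hi j }.

Definition in_box (d : nat) (p : point d) (B : box d) : Prop :=
  forall j : 'I_d, lo B j <= p j <= hi B j.

(* A family (a possibly infinite set of boxes) is 2-pierceable if some set of
   at most 2 points meets every member; a set of at most two points is {p, q}
   (p = q allowed). *)
Definition two_pierceable (d : nat) (G : box d -> Prop) : Prop :=
  exists p q : point d, forall B, G B -> in_box p B \/ in_box q B.

Definition tuple_family (d n : nat) (C : 'I_n -> box d) : box d -> Prop :=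
  fun B => exists j, B = C j.

Definition colorful (d m n : nat) (F : 'I_m -> box d -> Prop)
  (C : 'I_n -> box d) : Prop :=
  exists idx : 'I_n -> 'I_m, injective idx /\ forall j, F (idx j) (C j).

(* Main.v *)
Require Import Defs.
From Stdlib Require Import Reals Lra Classical ClassicalEpsilon.
From mathcomp Require Import all_boot.
From mathcomp Require Import zify.
Set Implicit Arguments. Unset Strict Implicit. Unset Printing Implicit Defensive.

(** Pairwise intersecting boxes have a common point, so a family is 2-pierceable
    iff its disjointness graph is bipartite.  In a colourful tuple, call a
    coordinate active when two boxes filling its two slots are disjoint in it; a
    proper 2-colouring amounts to a sign for each active coordinate, and a box
    avoiding slots of two coordinates imposes a linear equation over F_2 on
    these signs.  Two slots per active coordinate, plus independent equations,
    cost at most 3d - 1 colours, since the equations are always solvable and the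
    solutions come in antipodal pairs.  Take a tuple for which this cost is
    maximal, with slots that are hardest to improve.  Inactive coordinates
    separate no two colours, so each spoils at most one unused family, and there
    are enough unused colours to leave a family F_i intersecting in all of them.
    For a solution of the equations, a box of F_i or of the tuple cannot be
    avoided on two sides of opposite signs: otherwise an exchange of boxes would
    yield a further active coordinate or equation, or a harder slot.  Hence the
    signs 2-colour F_i together with the tuple. *)

(** * Classical preliminaries and pointwise updates *)

Lemma exists_max_nat (T : Type) (P : T -> Prop) (f : T -> nat) (N : nat) :
  (exists x, P x) -> (forall x, P x -> (f x <= N)%N) ->
  exists x, P x /\ forall y, P y -> (f y <= f x)%N.
Proof.
move=> [x Px] fN; move: {2}(N - f x)%N (leqnn (N - f x)%N) => n.
elim: n x Px => [|n IHn] x Px ltn.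
  by exists x; split=> // y Py; have := fN y Py; have := fN x Px; lia.
have [xmax|/not_all_ex_not [y xy]] := classic (forall y, P y -> (f y <= f x)%N).
  by exists x.
have [Py /negP fxy] := imply_to_and _ _ xy.
by apply: (IHn y) => //; have := fN y Py; lia.
Qed.

Definition propb (P : Prop) : bool :=
  if excluded_middle_informative P then true else false.

Lemma propP (P : Prop) : reflect P (propb P).
Proof. by rewrite /propb; case: excluded_middle_informative; constructor. Qed.

Section Update.
Variables (I : eqType) (T : Type).

Definition upd (f : I -> T) (i : I) (t : T) : I -> T :=
  fun k => if k == i then t else f k.

Lemma upd_same f i t : upd f i t i = t.
Proof. by rewrite /upd eqxx. Qed.

Lemma upd_other f i t k : k != i -> upd f i t k = f k.
Proof. by rewrite /upd => /negbTE ->. Qed.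

End Update.

(** * Sides of boxes *)

Section Sides.
Variable d : nat.

Definition side : Type := ('I_d * bool)%type.

Definition opp (a : side) : side := (a.1, ~~ a.2).

(* The position of the lower end if [a.2], and minus that of the upper end
   otherwise: a larger reach is a more extreme box on either side. *)
Definition reach (a : side) (B : box d) : R :=
  if a.2 then lo B a.1 else - hi B a.1.

Definition beyond (a : side) (B B' : box d) : Prop :=
  0 < reach a B + reach (opp a) B'.

Lemma oppK a : opp (opp a) = a.
Proof. by case: a => j b; rewrite /opp negbK. Qed.

Lemma beyond_opp a B B' : beyond a B B' -> beyond (opp a) B' B.
Proof. by rewrite /beyond oppK; lra. Qed.

Lemma beyond_reach a B B' Z :
  reach a B <= reach a B' -> beyond a B Z -> beyond a B' Z.
Proof. by rewrite /beyond; lra. Qed.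

Lemma not_beyond_reach a B B' Z :
  ~ beyond a B Z -> beyond a B' Z -> reach a B <= reach a B'.
Proof. by rewrite /beyond; lra. Qed.

(* Interval orders contain no 2+2. *)
Lemma beyond_cross a B B' Z Z' :
  beyond a B B' -> beyond a Z Z' -> beyond a B Z' \/ beyond a Z B'.
Proof.
rewrite /beyond => h h'.
have [|] := Rlt_le_dec 0 (reach a B + reach (opp a) Z'); first by left.
by right; lra.
Qed.

Lemma in_box_not_beyond a B B' p :
  in_box p B -> in_box p B' -> ~ beyond a B B'.
Proof.
move=> /(_ a.1) pB /(_ a.1) pB'; rewrite /beyond /reach /=.
by case: a.2 => /=; lra.
Qed.

(** The point is built from suprema of lower ends, one coordinate at a time, because an infinite
    family need not have a largest lower end. *)
Lemma helly_boxes (G : box d -> Prop) :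
  (forall a B B', G B -> G B' -> ~ beyond a B B') ->
  exists p : point d, forall B, G B -> in_box p B.
Proof.
move=> meet.
have [[B0 GB0]|noG] := classic (exists B, G B); last first.
  by exists (fun=> 0) => B GB; case: noG; exists B.
have lohi j B B' : G B -> G B' -> lo B j <= hi B' j.
  move=> GB GB'; have := meet (j, true) B B' GB GB'.
  by rewrite /beyond /reach /=; lra.
have lub j : { m : R | is_lub (fun x => exists2 B, G B & x = lo B j) m }.
  apply: completeness.
    by exists (hi B0 j) => x [B GB ->]; apply: lohi.
  by exists (lo B0 j), B0.
exists (fun j => proj1_sig (lub j)) => B GB j.
case: (lub j) => m [ubm lbm] /=; split; first by apply: ubm; exists B.
by apply: lbm => x [B' GB' ->]; apply: lohi.
Qed.

End Sides.

(** * Signs of the coordinates *)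

Section Signs.
Variables (d : nat) (K : finType).

Definition sign_vec : finType := {ffun 'I_d -> bool}.

(** The piercing point intended for the box in slot [a]; the two slots of a coordinate hold disjoint
    boxes, so they get opposite values. *)
Definition sign_at (s : sign_vec) (a : side d) : bool := s a.1 (+) a.2.

Definition link : Type := (K * (side d * side d))%type.

Definition sol (E : seq link) : {set sign_vec} :=
  [set s : sign_vec | all (fun e : link => sign_at s e.2.1 == sign_at s e.2.2) E].

Lemma sign_at_opp s a : sign_at s (opp a) = ~~ sign_at s a.
Proof. by rewrite /sign_at /=; case: (s _); case: a.2. Qed.

Lemma solP (E : seq link) s :
  reflect (forall e, e \in E -> sign_at s e.2.1 = sign_at s e.2.2) (s \in sol E).
Proof.
rewrite inE; apply: (iffP allP) => h e he; first by apply/eqP; apply: h.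
by rewrite h.
Qed.

(** Affine subspaces over F_2 are closed under sums of three points. *)
Definition xor3 (s t u : sign_vec) : sign_vec := [ffun j => s j (+) t j (+) u j].

Lemma sign_at_xor3 s t u a :
  sign_at (xor3 s t u) a = sign_at s a (+) sign_at t a (+) sign_at u a.
Proof. by rewrite /sign_at ffunE; case: (s _); case: (t _); case: (u _); case: a.2. Qed.

(* Translation by [s + t], for [t] solving the new equation, maps solutions to
   non-solutions. *)
Lemma card_sol_cons (E : seq link) (e : link) s :
  s \in sol E -> sign_at s e.2.1 <> sign_at s e.2.2 ->
  (#|sol (e :: E)| * 2 <= #|sol E|)%N.
Proof.
move=> sE se.
have [->|[t tE]] := set_0Vmem (sol (e :: E)); first by rewrite cards0.
have sub : sol (e :: E) \subset sol E.
  by apply/subsetP => u; rewrite !inE /= => /andP[].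
have inj : injective (xor3 s t).
  move=> u v /ffunP uv; apply/ffunP => j; move: (uv j); rewrite !ffunE.
  exact: addbI.
have im : xor3 s t @: sol (e :: E) \subset sol E :\: sol (e :: E).
  apply/subsetP => _ /imsetP[u ue ->]; rewrite inE; apply/andP; split.
    apply/negP => /solP /(_ e (mem_head _ _)); rewrite !sign_at_xor3.
    move/solP: tE => /(_ e (mem_head _ _)) ->.
    move/solP: ue => /(_ e (mem_head _ _)) ->.
    by move/addIb/addIb.
  apply/solP => f fE; rewrite !sign_at_xor3.
  move/solP: sE => /(_ f fE) ->.
  have fE' : f \in e :: E by rewrite inE fE orbT.
  by move/solP: tE => /(_ f fE') ->; move/solP: ue => /(_ f fE') ->.
have := subset_leq_card im.
rewrite card_imset // cardsD (setIidPr sub).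
by have := subset_leq_card sub; lia.
Qed.

(* A solution may be flipped on all of [A] at once and freely outside [A]. *)
Lemma card_sol_ge (E : seq link) (A : {set 'I_d}) s j0 :
  s \in sol E -> j0 \in A ->
  (forall e, e \in E -> e.2.1.1 \in A /\ e.2.2.1 \in A) ->
  (2 ^ (d - #|A|).+1 <= #|sol E|)%N.
Proof.
move=> sE j0A EA.
pose T := j0 |: ~: A.
have cT : #|T| = (d - #|A|).+1.
  by rewrite cardsU1 inE j0A /= add1n cardsCs setCK card_ord.
pose flip (U : {set 'I_d}) : sign_vec :=
  [ffun j => s j (+) (if j \in A then j0 \in U else j \in U)].
have sf U a : a.1 \in A -> sign_at (flip U) a = sign_at s a (+) (j0 \in U).
  by move=> aA; rewrite /sign_at ffunE aA addbAC.
have inj : {in powerset T &, injective flip}.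
  move=> U V; rewrite !inE => UT VT /ffunP UV; apply/setP => j.
  have j0UV : (j0 \in U) = (j0 \in V).
    by move: (UV j0); rewrite !ffunE j0A => /addbI.
  have [jT|jT] := boolP (j \in T); last first.
    by rewrite (contraNF (subsetP UT j)) // (contraNF (subsetP VT j)).
  move: jT; rewrite !inE; case: eqP => [->//|_ /= jA].
  by move: (UV j); rewrite !ffunE (negbTE jA) => /addbI.
rewrite -cT -card_powerset -(card_in_imset inj).
apply/subset_leq_card/subsetP => _ /imsetP[U UT ->]; apply/solP => e eE.
by have [h1 h2] := EA e eE; rewrite !sf // (solP _ _ sE e eE).
Qed.

End Signs.

(** * Configurations *)

Section Configurations.
Variables (d : nat) (K : finType) (F : K -> box d -> Prop).
Hypothesis pierce : forall C : K -> box d,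
  (forall k, F k (C k)) -> two_pierceable (fun B => exists k, B = C k).

(* A link [(m, (a, b))] records that the box of colour [m] avoids the boxes in
   the slots [a] and [b], which forces these two onto the same piercing point. *)
Record config := Config {
  tup : K -> box d;
  slot : side d -> K;
  act : {set 'I_d};
  links : seq (link d K) }.

(** For a solvable system the cardinality bound says exactly that the links are linearly independent
    equations. *)
Definition valid (S : config) : Prop :=
  [/\ forall k, F k (tup S k),
      forall a, a.1 \in act S ->
        beyond a (tup S (slot S a)) (tup S (slot S (opp a))),
      forall e, e \in links S ->
        [/\ e.2.1.1 \in act S, e.2.2.1 \in act S,
            beyond e.2.1 (tup S (slot S e.2.1)) (tup S e.1) &
            beyond e.2.2 (tup S (slot S e.2.2)) (tup S e.1)] &
      (#|sol (links S)| * 2 ^ size (links S) <= 2 ^ d)%N].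

Lemma card_act (S : config) : (#|act S| <= d)%N.
Proof. by apply: leq_trans (max_card _) _; rewrite card_ord. Qed.

(** Colour by membership of the first piercing point: disjoint boxes cannot share it, nor can both
    miss it, as they would then share the second. *)
Lemma two_coloring (C : K -> box d) : (forall k, F k (C k)) ->
  exists col : K -> bool,
    forall a k l, beyond a (C k) (C l) -> col l = ~~ col k.
Proof.
move=> /pierce [p [q pq]]; exists (fun k => propb (in_box p (C k))) => a k l kl.
have pqC m : in_box p (C m) \/ in_box q (C m) by apply: pq; exists m.
case: (propP (in_box p (C k))) => pk; case: (propP (in_box p (C l))) => pl //.
  by case: (in_box_not_beyond pk pl kl).
have [//|qk] := pqC k; have [//|ql] := pqC l.
by case: (in_box_not_beyond qk ql kl).
Qed.

(** The colours of the slots in a 2-colouring form a solution: both slots of a link are coloured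
    opposite to the box avoiding them. *)
Lemma sol_nonempty (S : config) : valid S -> exists s, s \in sol (links S).
Proof.
move=> [FS actS linkS _]; have [col colP] := two_coloring FS.
pose s : sign_vec d := [ffun j => col (slot S (j, false))].
have sE a : a.1 \in act S -> sign_at s a = col (slot S a).
  case: a => j [] /= jA; rewrite /sign_at ffunE /= ?addbF // addbT.
  by rewrite (colP _ _ _ (actS (j, false) jA)).
exists s; apply/solP => e /linkS[A1 A2 h1 h2]; rewrite !sE //.
by apply: negb_inj; rewrite -(colP _ _ _ h1) -(colP _ _ _ h2).
Qed.

(** Flipping all active signs together preserves the equations, which yields one more factor 2 of
    solutions than the free inactive signs alone; independence bounds the number from above. *)
Lemma size_links (S : config) j0 :
  valid S -> j0 \in act S -> (size (links S) < #|act S|)%N.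
Proof.
move=> vS j0A; have [s sS] := sol_nonempty vS.
have [_ _ linkS cardS] := vS.
have EA e : e \in links S -> e.2.1.1 \in act S /\ e.2.2.1 \in act S.
  by move=> /linkS[].
have := leq_trans (leq_mul (card_sol_ge sS j0A EA) (leqnn _)) cardS.
by rewrite -expnD leq_exp2l //; have := card_act S; lia.
Qed.

Lemma links_nil (S : config) : valid S -> act S = set0 -> links S = [::].
Proof.
move=> [_ _ linkS _] A0; case: (links S) linkS => // e E /(_ e (mem_head _ _)).
by rewrite A0 in_set0 => -[].
Qed.

Definition rank (S : config) : nat := (2 * #|act S| + size (links S))%N.

Lemma rank_bound S : valid S -> (rank S <= 3 * d)%N.
Proof.
move=> vS; rewrite /rank; have := card_act S.
have [A0|[j jA]] := set_0Vmem (act S).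
  by rewrite (links_nil vS A0) /=; lia.
by have := size_links vS jA; lia.
Qed.

Definition used (S : config) : {set K} :=
  [set slot S a | a in [pred a : side d | a.1 \in act S]] :|:
  [set k | k \in map fst (links S)].

Lemma slot_used S a : a.1 \in act S -> slot S a \in used S.
Proof. by move=> aA; rewrite inE; apply/orP; left; apply: imset_f. Qed.

Lemma link_used S e : e \in links S -> e.1 \in used S.
Proof. by move=> eE; rewrite !inE (map_f fst eE) orbT. Qed.

Lemma usedP S k : k \in used S ->
  (exists2 a, a.1 \in act S & k = slot S a) \/
  (exists2 e, e \in links S & k = e.1).
Proof.
rewrite !inE => /orP[/imsetP[a]|/mapP[e eE ->]]; last by right; exists e.
by rewrite inE => aA ->; left; exists a.
Qed.

Lemma card_used S : (#|used S| <= rank S)%N.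
Proof.
rewrite /used /rank; apply: leq_trans (leq_card_setU _ _) _.
apply: leq_add.
  apply: leq_trans (leq_imset_card _ _) _.
  rewrite mulnC -card_bool -cardX; apply: subset_leq_card.
  by apply/subsetP => a; rewrite !inE andbT.
rewrite -(size_map fst); apply: leq_trans (card_size _).
by apply: subset_leq_card; apply/subsetP => k; rewrite inE.
Qed.

(* Extreme boxes need not exist in infinite families; minimising this finite set
   replaces their choice: a colour that loses a slot to a box it cannot match
   never gets that slot back. *)
Definition rivals (S : config) : {set side d * K} :=
  [set x | (x.1.1 \in act S) &&
     propb (exists2 W, F x.2 W & reach x.1 (tup S (slot S x.1)) <= reach x.1 W)].

(** A lexicographic choice. The last criterion ensures that an exchange bringing in a new colour has
    to drop an old one. *)
Definition optimal (S : config) : Prop :=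
  [/\ valid S,
      forall T, valid T -> (rank T <= rank S)%N,
      forall T, valid T -> rank T = rank S -> (#|rivals S| <= #|rivals T|)%N &
      forall T, valid T -> rank T = rank S -> #|rivals T| = #|rivals S| ->
        (#|used T| <= #|used S|)%N].

Lemma optimal_exists (k0 : K) : (forall k, exists B, F k B) ->
  exists S, optimal S.
Proof.
move=> Fne.
pose C k := proj1_sig (constructive_indefinite_description _ (Fne k)).
have FC k : F k (C k) by rewrite /C; case: constructive_indefinite_description.
have v0 : valid (Config C (fun=> k0) set0 [::]).
  split=> //=; first by move=> a; rewrite in_set0.
  rewrite muln1; apply: leq_trans (max_card _) _.
  by rewrite card_ffun card_bool card_ord.
have [S1 [v1 max1]] :=
  exists_max_nat (ex_intro valid _ v0) (fun S => @rank_bound S).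
pose N := #|{: side d * K}|.
have cN S : (#|rivals S| <= N)%N by apply: max_card.
have [//||S2 [[v2 r2] max2]] := @exists_max_nat config
    (fun S => valid S /\ rank S = rank S1) (fun S => N - #|rivals S|)%N N.
- by exists S1.
- by move=> S _; lia.
have [//||S3 [[v3 r3 c3] max3]] := @exists_max_nat config
    (fun S => [/\ valid S, rank S = rank S1 & #|rivals S| = #|rivals S2|])
    (fun S => #|used S|) #|K|.
- by exists S2.
- by move=> S _; apply: max_card.
exists S3; split=> // T vT; rewrite ?r3 ?c3; first exact: max1.
  move=> rT; have := max2 T (conj vT rT).
  by have := cN T; have := cN S2; lia.
by move=> rT cT; apply: max3; split.
Qed.

Definition recast (S : config) C X := Config C X (act S) (links S).

(** Slot boxes may only move outwards and link boxes stay put, so every required separation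
    survives. *)
Definition refines (S : config) (C : K -> box d) (X : side d -> K) : Prop :=
  [/\ forall k, F k (C k),
      forall e, e \in links S -> C e.1 = tup S e.1 &
      forall a, a.1 \in act S -> reach a (tup S (slot S a)) <= reach a (C (X a))].

Lemma valid_recast S C X : valid S -> refines S C X -> valid (recast S C X).
Proof.
move=> [FS actS linkS cardS] [FC CE CX]; split=> //=.
  by move=> a aA; move: (actS a aA) (CX a aA) (CX (opp a) aA); rewrite /beyond; lra.
move=> e eE; have [A1 A2 h1 h2] := linkS e eE; rewrite CE //; split=> //.
  exact: beyond_reach (CX _ A1) h1.
exact: beyond_reach (CX _ A2) h2.
Qed.

(** * Consequences of maximal rank *)

Section MaximalRank.
Variable S : config.
Hypothesis vS : valid S.
Hypothesis maxS : forall T, valid T -> (rank T <= rank S)%N.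

Lemma no_new_coordinate a k l :
  a.1 \notin act S -> ~ beyond a (tup S k) (tup S l).
Proof.
move=> aA kl; have [FS actS linkS cardS] := vS.
pose X := upd (upd (slot S) a k) (opp a) l.
have ao : a != opp a.
  by case: (a) => j b; apply/eqP => -[]; case: b.
have XA b : b.1 \in act S -> X b = slot S b.
  move=> bA; rewrite /X !upd_other //; apply: contraNneq aA; first by move<-.
  by move=> ba; rewrite ba in bA.
have Xa : X a = k by rewrite /X upd_other // upd_same.
have Xo : X (opp a) = l by rewrite /X upd_same.
pose T := Config (tup S) X (a.1 |: act S) (links S).
suff /maxS : valid T by rewrite /rank /= cardsU1 aA leq_add2r leq_pmul2l // add1n ltnn.
split=> //= [b|e eE].
  rewrite in_setU1 => /orP[/eqP ba|bA]; last by rewrite !XA //; apply: actS.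
  have [->|->] : b = a \/ b = opp a.
    case: b a ba {aA kl X ao XA Xa Xo T} => j [] [j' []] /= ->; rewrite /opp /=; tauto.
  - by rewrite Xa Xo.
  - by rewrite oppK Xa Xo; apply: beyond_opp.
by have [A1 A2 h1 h2] := linkS e eE; rewrite !XA // !in_setU1 A1 A2 !orbT.
Qed.

(** Otherwise [s] violates the equation of the link [(k, (a, b))], which is therefore independent of
    the others and could be added. *)
Lemma avoided_slots_agree s a b k : s \in sol (links S) ->
  a.1 \in act S -> b.1 \in act S ->
  beyond a (tup S (slot S a)) (tup S k) ->
  beyond b (tup S (slot S b)) (tup S k) -> sign_at s a = sign_at s b.
Proof.
move=> sS aA bA ha hb; have [FS actS linkS cardS] := vS.
apply/eqP/negPn/negP => /eqP sab.
pose T := Config (tup S) (slot S) (act S) ((k, (a, b)) :: links S).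
suff /maxS : valid T by rewrite /rank /=; lia.
split=> //= [e|].
  by rewrite inE => /orP[/eqP ->|/linkS].
have := @card_sol_cons _ _ _ (k, (a, b)) _ sS sab.
rewrite expnS mulnA => h; apply: leq_trans cardS.
by rewrite leq_mul2r h orbT.
Qed.

End MaximalRank.

(** * Exchanges of boxes in an optimal configuration *)

Section Optimal.
Variables (S : config) (i : K) (s : sign_vec d).
Hypothesis optS : optimal S.
Hypothesis i_unused : i \notin used S.
Hypothesis sS : s \in sol (links S).

Let C0 := tup S.
Let X0 := slot S.

Lemma valid_optimal : valid S. Proof. by case: optS. Qed.

Lemma slot_neq_unused a : a.1 \in act S -> X0 a != i.
Proof. by move=> aA; apply: contraNneq i_unused => <-; apply: slot_used. Qed.

Lemma link_neq_unused e : e \in links S -> e.1 != i.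
Proof. by move=> eE; apply: contraNneq i_unused => <-; apply: link_used. Qed.

(** Extends [avoided_slots_agree] from slot boxes to arbitrary boxes of a refinement, by moving the
    offending boxes into the slots [a] and [b]. *)
Lemma no_clash C a b c c' k : refines S C X0 ->
  a.1 \in act S -> b.1 \in act S -> sign_at s a <> sign_at s b ->
  beyond a (C c) (C k) -> beyond b (C c') (C k) -> False.
Proof.
move=> [FC CE CX] aA bA sab ca cb.
(* A slot box not beyond [C k] is outreached by one that is, so replacing it is a refinement. For
   inactive [e] the choice [k] is a dummy. *)
have best e : exists m, e.1 \in act S ->
    [/\ reach e (C0 (X0 e)) <= reach e (C m),
        e = a -> beyond e (C m) (C k) & e = b -> beyond e (C m) (C k)].
  have [eA|] := boolP (e.1 \in act S); last by exists k.
  have [h|h] := classic (beyond e (C (X0 e)) (C k)).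
    by exists (X0 e) => _; split=> //; apply: CX.
  have [ea|nea] := classic (e = a).
    exists c => _; rewrite {}ea in eA h *; split=> //.
    exact: Rle_trans (CX _ eA) (not_beyond_reach h ca).
  have [eb|neb] := classic (e = b).
    exists c' => _; rewrite {}eb in eA h nea *; split=> //.
    exact: Rle_trans (CX _ eA) (not_beyond_reach h cb).
  by exists (X0 e) => _; split=> //; apply: CX.
pose X e := proj1_sig (constructive_indefinite_description _ (best e)).
have XP e (eA : e.1 \in act S) :
    [/\ reach e (C0 (X0 e)) <= reach e (C (X e)),
        e = a -> beyond e (C (X e)) (C k) & e = b -> beyond e (C (X e)) (C k)].
  by move: eA; rewrite /X; case: constructive_indefinite_description.
have ref : refines S C X by split=> // e /XP[].
have [vS maxS _ _] := optS.
apply: sab; apply: (avoided_slots_agree (valid_recast vS ref)) sS _ _ _ _ => //=.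
- by have [_ h _] := XP a aA; apply: h.
- by have [_ _ h] := XP b bA; apply: h.
Qed.

(** Slots that reach further can only lose rivals, so minimality keeps all of them; among these is
    the pair of [a] and its old colour. *)
Lemma rival_of_refinement C X a : refines S C X -> a.1 \in act S ->
  exists2 W, F (X0 a) W & reach a (C (X a)) <= reach a W.
Proof.
move=> ref aA; have [vS _ minS _] := optS; have [_ _ CX] := ref.
have sub : rivals (recast S C X) \subset rivals S.
  apply/subsetP => -[b k]; rewrite !inE /= => /andP[bA /propP[W FW bW]].
  rewrite bA; apply/propP; exists W => //.
  exact: Rle_trans (CX b bA) bW.
have eqr : rivals (recast S C X) = rivals S.
  apply/eqP; rewrite eqEcard sub; apply: minS => //; exact: valid_recast.
have : (a, X0 a) \in rivals S.
  rewrite inE aA; apply/propP; exists (C0 (X0 a)); last exact: Rle_refl.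
  by case: vS.
by rewrite -eqr inE aA => /propP.
Qed.

Lemma card_used_refinement C X :
  refines S C X -> (#|used (recast S C X)| <= #|used S|)%N.
Proof.
move=> ref; have [vS _ minS maxU] := optS.
apply: maxU => //; first exact: valid_recast.
apply/eqP; rewrite eqn_leq minS ?andbT //; last exact: valid_recast.
apply: subset_leq_card; have [_ _ CX] := ref.
apply/subsetP => -[b k]; rewrite !inE /= => /andP[bA /propP[W FW bW]].
rewrite bA; apply/propP; exists W => //.
exact: Rle_trans (CX b bA) bW.
Qed.

(** The box of colour [X0 a] is then constrained by slot [a] only, and may be exchanged for any box
    of its family reaching at least as far there. *)
Definition sole (a : side d) : Prop :=
  (forall e, e \in links S -> e.1 != X0 a) /\
  (forall b, b.1 \in act S -> b != a -> X0 b != X0 a).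

(** If [X0 a] stayed in use as well, the refinement would use all old colours and [i], contradicting
    the maximality of [used]. *)
Lemma sole_of_refinement C X a : refines S C X ->
  i \in used (recast S C X) ->
  (forall b, b.1 \in act S -> b != a -> X0 b \in used (recast S C X)) -> sole a.
Proof.
move=> ref iU slU; set U := used _ in iU slU.
have lkU e : e \in links S -> e.1 \in U by apply: (@link_used (recast S C X)).
have aU : X0 a \notin U.
  apply/negP => aU; have : i |: used S \subset U.
    apply/subsetP => k; rewrite in_setU1 => /orP[/eqP -> //|/usedP[]].
      move=> [b bA ->]; have [->//|] := eqVneq b a; exact: slU.
    by move=> [e eE ->]; apply: lkU.
  move/subset_leq_card; rewrite cardsU1 i_unused add1n => lt.
  by have := leq_trans lt (card_used_refinement ref); rewrite ltnn.
split=> [e eE|b bA ba]; apply: contraNneq aU => <-; [exact: lkU | exact: slU].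
Qed.

Lemma refines_refl : refines S C0 X0.
Proof.
have [FS _ _ _] := valid_optimal.
by split=> // a _; apply: Rle_refl.
Qed.

Lemma refines_unused C V : refines S C X0 -> F i V -> refines S (upd C i V) X0.
Proof.
move=> [FC CE CX] FV; split=> [k|e eE|a aA].
- by rewrite /upd; case: eqP => [->|].
- by rewrite upd_other ?CE // link_neq_unused.
- by rewrite upd_other ?slot_neq_unused //; apply: CX.
Qed.

Lemma refines_sole C a W : refines S C X0 -> sole a ->
  F (X0 a) W -> reach a (C0 (X0 a)) <= reach a W ->
  refines S (upd C (X0 a) W) X0.
Proof.
move=> [FC CE CX] [sl sb] FW aW; split=> [k|e eE|b bA].
- by rewrite /upd; case: eqP => [->|].
- by rewrite upd_other ?CE // sl.
- have [->|ba] := eqVneq b a; first by rewrite upd_same.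
  by rewrite upd_other ?sb //; apply: CX.
Qed.

Lemma replace_slot a V : a.1 \in act S -> F i V ->
  reach a (C0 (X0 a)) <= reach a V ->
  sole a /\ exists2 W, F (X0 a) W & reach a V <= reach a W.
Proof.
move=> aA FV aV; pose C := upd C0 i V; pose X := upd X0 a i.
have [FC CE CX] := refines_unused refines_refl FV.
have ref : refines S C X.
  split=> // b bA; have [->|ba] := eqVneq b a; first by rewrite /X /C !upd_same.
  by rewrite /X (upd_other _ _ ba); apply: CX.
have XU b : b.1 \in act S -> X b \in used (recast S C X).
  exact: (@slot_used (recast S C X)).
split.
  apply: (sole_of_refinement ref).
    by have := XU a aA; rewrite /X upd_same.
  by move=> b bA ba; have := XU b bA; rewrite /X upd_other.
by have := rival_of_refinement ref aA; rewrite /X /C !upd_same.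
Qed.

(** A two-step exchange: [V] takes over slot [a], and the box released there takes over slot [b]. *)
Lemma replace_slot_by_slot a b V : a.1 \in act S -> b.1 \in act S -> a != b ->
  F i V -> reach a (C0 (X0 a)) <= reach a V ->
  reach b (C0 (X0 b)) <= reach b (C0 (X0 a)) ->
  sole b /\ exists2 W, F (X0 b) W & reach b (C0 (X0 a)) <= reach b W.
Proof.
move=> aA bA ab FV aV bC; pose C := upd C0 i V; pose X := upd (upd X0 a i) b (X0 a).
have [FC CE CX] := refines_unused refines_refl FV.
have Xa : X a = i by rewrite /X upd_other // upd_same.
have Xb : X b = X0 a by rewrite /X upd_same.
have Cb : C (X0 a) = C0 (X0 a) by rewrite /C upd_other // slot_neq_unused.
have ref : refines S C X.
  split=> // c cA; have [->|cb] := eqVneq c b; first by rewrite Xb Cb.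
  have [->|ca] := eqVneq c a; first by rewrite Xa /C upd_same.
  by rewrite /X !upd_other //; apply: CX.
have XU c : c.1 \in act S -> X c \in used (recast S C X).
  exact: (@slot_used (recast S C X)).
split.
  apply: (sole_of_refinement ref).
    by have := XU a aA; rewrite Xa.
  move=> c cA cb; have [->|ca] := eqVneq c a; first by rewrite -Xb; apply: XU.
  by have := XU c cA; rewrite /X !upd_other.
by have := rival_of_refinement ref bA; rewrite Xb Cb.
Qed.

(** * Two-colouring the family F_i together with the tuple *)

Definition final_family (B : box d) : Prop :=
  F i B \/ exists2 k, k <> i & B = C0 k.

(** If no tuple box of another colour is beyond [Z], then in particular the slot box is not, so [Z']
    outreaches it and [replace_slot] applies. *)
Lemma beyond_cases a Z Z' : a.1 \in act S -> final_family Z' -> beyond a Z' Z ->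
  (exists2 c, c != i & beyond a (C0 c) Z) \/
  [/\ F i Z', reach a (C0 (X0 a)) <= reach a Z', sole a &
      exists2 W, F (X0 a) W & reach a Z' <= reach a W].
Proof.
move=> aA HZ' aZ.
have [|far] := classic (exists2 c, c != i & beyond a (C0 c) Z); first by left.
case: HZ' => [FZ'|[k /eqP ki Z'k]]; last by case: far; exists k; rewrite -?Z'k.
have aZ' : reach a (C0 (X0 a)) <= reach a Z'.
  apply: not_beyond_reach aZ => h; apply: far.
  by exists (X0 a) => //; apply: slot_neq_unused.
by right; have [so W] := replace_slot aA FZ' aZ'; split.
Qed.

Section Clash.
Variables (Z : box d) (a b : side d).
Hypothesis aA : a.1 \in act S.
Hypothesis bA : b.1 \in act S.
Hypothesis sab : sign_at s a <> sign_at s b.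

(** A tuple has room for only one box of F_i. Colour [i] is given to [Z], and a rival [W] of colour
    [X0 a] stands in for [Z']. *)
Lemma clash_fixed_end c Z' : F i Z -> F i Z' -> beyond a Z' Z ->
  reach a (C0 (X0 a)) <= reach a Z' -> c != i -> beyond b (C0 c) Z -> False.
Proof.
move=> FZ FZ' aZ aX ci bc.
have ab : a != b by apply/eqP => eab; apply: sab; rewrite eab.
have [soa [W FW aW]] := replace_slot aA FZ' aX.
have FaW := Rle_trans _ _ _ aX aW.
have aWZ := beyond_reach aW aZ.
have ref1 := refines_sole (refines_unused refines_refl FZ) soa FW FaW.
set C := upd _ _ _ in ref1.
have Ci : C i = Z by rewrite /C upd_other ?upd_same // eq_sym slot_neq_unused.
have Ca : C (X0 a) = W by rewrite /C upd_same.
(* The trouble is that [W] overwrites the box of colour [X0 a], which may be the only one beyond [Z]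
   on side [b]. In that case it outreaches slot [b], and a rival of colour [X0 b] replaces it. *)
have [[c' [c'i c'a] bc']|only] :=
    classic (exists2 c', c' != i /\ c' != X0 a & beyond b (C0 c') Z).
  apply: (@no_clash C a b (X0 a) c' i ref1) => //; rewrite ?Ca Ci //.
  by rewrite /C !upd_other.
have bXZ : ~ beyond b (C0 (X0 b)) Z.
  move=> h; apply: only; exists (X0 b) => //; split; first exact: slot_neq_unused.
  by case: soa => _; apply=> //; rewrite eq_sym.
have ca : c = X0 a.
  by apply/eqP/negPn/negP => nca; apply: only; exists c.
rewrite ca in bc.
have bX := not_beyond_reach bXZ bc.
have [sob [W' FW' bW']] := replace_slot_by_slot aA bA ab FZ' aX bX.
have ref2 := refines_sole ref1 sob FW' (Rle_trans _ _ _ bX bW').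
have nba : X0 a != X0 b by case: sob => _; apply.
apply: (@no_clash _ a b (X0 a) (X0 b) i ref2) => //.
  rewrite upd_other // Ca upd_other ?Ci // eq_sym; exact: slot_neq_unused.
rewrite upd_same upd_other ?Ci; first exact: beyond_reach bW' bc.
by rewrite eq_sym; exact: slot_neq_unused.
Qed.

End Clash.

(** In each case at most one of the three boxes keeps colour [i]; the others are tuple boxes or are
    replaced by rivals from sole slots. *)
Lemma no_final_clash Z Z' Z'' a b :
  final_family Z -> final_family Z' -> final_family Z'' ->
  a.1 \in act S -> b.1 \in act S -> sign_at s a <> sign_at s b ->
  beyond a Z' Z -> beyond b Z'' Z -> False.
Proof.
move=> HZ HZ' HZ'' aA bA sab aZ bZ.
have sba : sign_at s b <> sign_at s a by move=> h; apply: sab.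
have ab : a != b by apply/eqP => eab; apply: sab; rewrite eab.
have iXa : i != X0 a by rewrite eq_sym slot_neq_unused.
have iXb : i != X0 b by rewrite eq_sym slot_neq_unused.
case: (beyond_cases aA HZ' aZ) => [[c ci ac]|[FZ' aX soa [W FW aW]]];
case: (beyond_cases bA HZ'' bZ) => [[c' c'i bc']|[FZ'' bX sob [W' FW' bW']]];
case: HZ => [FZ|[l /eqP li Zl]].
- apply: (no_clash (c := c) (c' := c') (k := i)
    (refines_unused refines_refl FZ) aA bA sab).
    by rewrite upd_same upd_other.
  by rewrite upd_same upd_other.
- by apply: (no_clash (c := c) (c' := c') (k := l) refines_refl aA bA sab);
    rewrite -Zl.
- exact: (clash_fixed_end bA aA sba FZ FZ'' bZ bX ci ac).
- apply: (no_clash (c := c) (c' := i) (k := l)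
    (refines_unused refines_refl FZ'') aA bA sab).
    by rewrite !upd_other // -Zl.
  by rewrite upd_same upd_other // -Zl.
- exact: (clash_fixed_end aA bA sab FZ FZ' aZ aX c'i bc').
- apply: (no_clash (c := i) (c' := c') (k := l)
    (refines_unused refines_refl FZ') aA bA sab).
    by rewrite upd_same upd_other // -Zl.
  by rewrite !upd_other // -Zl.
- have ref := refines_sole (refines_sole (refines_unused refines_refl FZ)
    soa FW (Rle_trans _ _ _ aX aW)) sob FW' (Rle_trans _ _ _ bX bW').
  have nab : X0 a != X0 b by case: sob => _; apply.
  apply: (no_clash (c := X0 a) (c' := X0 b) (k := i) ref aA bA sab).
    rewrite upd_other // upd_same (upd_other _ _ iXb) (upd_other _ _ iXa) upd_same.
    exact: beyond_reach aW aZ.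
  rewrite upd_same (upd_other _ _ iXb) (upd_other _ _ iXa) upd_same.
  exact: beyond_reach bW' bZ.
(* [Z] is itself a tuple box here, so the rival must be placed in the slot whose colour is not that
   of [Z]. *)
- have [la|la] := eqVneq l (X0 a); last first.
    have ref := refines_sole (refines_unused refines_refl FZ'')
      soa FW (Rle_trans _ _ _ aX aW).
    apply: (no_clash (c := X0 a) (c' := i) (k := l) ref aA bA sab).
      by rewrite upd_same !upd_other // -Zl; apply: beyond_reach aW aZ.
    rewrite (upd_other _ _ iXa) upd_same.
    by rewrite !upd_other // -Zl.
  have lb : l != X0 b by rewrite la; case: sob => _; apply.
  have ref := refines_sole (refines_unused refines_refl FZ')
    sob FW' (Rle_trans _ _ _ bX bW').
  apply: (no_clash (c := i) (c' := X0 b) (k := l) ref aA bA sab).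
    rewrite (upd_other _ _ iXb) upd_same.
    by rewrite !upd_other // -Zl.
  by rewrite upd_same !upd_other // -Zl; apply: beyond_reach bW' bZ.
Qed.

Lemma final_family_disjoint_active a B B' :
  (forall a B B', a.1 \notin act S -> F i B -> F i B' -> ~ beyond a B B') ->
  final_family B -> final_family B' -> beyond a B B' -> a.1 \in act S.
Proof.
move=> Fi HB HB' aB; apply/negPn/negP => aA.
have [vS maxS _ _] := optS.
have noF C k l : refines S C X0 -> ~ beyond a (C k) (C l).
  move=> ref; apply: (no_new_coordinate (valid_recast vS ref)) aA => //.
case: HB HB' => [FB|[k /eqP ki Bk]] [FB'|[l /eqP li Bl]].
- exact: (Fi a B B').
- apply: (noF _ i l (refines_unused refines_refl FB)).
  by rewrite upd_same upd_other // -Bl.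
- apply: (noF _ k i (refines_unused refines_refl FB')).
  by rewrite upd_same upd_other // -Bk.
- by apply: (noF _ k l refines_refl); rewrite -Bk -Bl.
Qed.

Lemma final_family_pierceable :
  (forall a B B', a.1 \notin act S -> F i B -> F i B' -> ~ beyond a B B') ->
  two_pierceable final_family.
Proof.
move=> Fi.
(* The colour class of the boxes avoided on a positive side. By [no_final_clash] such a box is
   avoided on no negative side, so disjoint boxes fall into different classes. *)
pose low B := exists Z a, [/\ final_family Z, a.1 \in act S, sign_at s a & beyond a Z B].
have proper a B B' : final_family B -> final_family B' -> beyond a B B' ->
    (low B /\ ~ low B') \/ (~ low B /\ low B').
  move=> HB HB' aB; have aA := final_family_disjoint_active Fi HB HB' aB.
  have aB' := beyond_opp aB.
  have [sa|sa] := boolP (sign_at s a).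
    right; split; last by exists B, a.
    move=> [Z [b [HZ bA sb bZ]]].
    by apply: (no_final_clash HB HZ HB' bA (b := opp a)) bZ aB'; rewrite // sign_at_opp sa sb.
  left; split; first by exists B', (opp a); split; rewrite // sign_at_opp.
  move=> [Z [b [HZ bA sb bZ]]].
  by apply: (no_final_clash HB' HZ HB bA aA) bZ aB; rewrite sb; case: (sign_at s a) sa.
have [p pP] : exists p : point d, forall B, final_family B /\ low B -> in_box p B.
  apply: helly_boxes => a B B' [HB lB] [HB' lB'] aB.
  by case: (proper a B B' HB HB' aB) => -[].
have [q qP] : exists q : point d, forall B, final_family B /\ ~ low B -> in_box q B.
  apply: helly_boxes => a B B' [HB lB] [HB' lB'] aB.
  by case: (proper a B B' HB HB' aB) => -[].
exists p, q => B HB; have [lB|lB] := classic (low B); [left|right].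
  exact: pP.
exact: qP.
Qed.

End Optimal.

Lemma unused_color_exists S : (0 < d)%N -> #|K| = (3 * d)%N -> optimal S ->
  exists2 i, i \notin used S &
    forall a B B', a.1 \notin act S -> F i B -> F i B' -> ~ beyond a B B'.
Proof.
move=> d0 cK optS; have [vS maxS _ _] := optS.
apply: NNPP => none.
have bad i : exists j, i \notin used S ->
    j \notin act S /\ exists B B', [/\ F i B, F i B' & beyond (j, false) B B'].
  have [iU|iU] := boolP (i \in used S); first by exists (Ordinal d0).
  have [[j [jA h]]|good] := classic (exists j, j \notin act S /\
      exists B B', [/\ F i B, F i B' & beyond (j, false) B B']).
    by exists j.
  case: none; exists i => // -[j b] B B' /= jA FB FB' bB; apply: good; exists j.
  split=> //; case: b bB => bB; last by exists B, B'.
  by exists B', B; split=> //; apply: (beyond_opp bB).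
pose J i := proj1_sig (constructive_indefinite_description _ (bad i)).
have JP i : i \notin used S -> J i \notin act S /\
    exists B B', [/\ F i B, F i B' & beyond (J i, false) B B'].
  by rewrite /J; case: constructive_indefinite_description.
have inj : {in ~: used S &, injective J}.
  move=> i k; rewrite !in_setC => iU kU Jik.
  apply/eqP/negPn/negP => ik.
  have [jA [B [B' [FB FB' bB]]]] := JP i iU.
  have [_ [D [D' [FD FD' bD]]]] := JP k kU.
  rewrite -Jik in bD.
  have noF i' k' Y Y' : i' \notin used S -> k' \notin used S -> i' != k' ->
      F i' Y -> F k' Y' -> ~ beyond (J i, false) Y Y'.
    move=> iU' kU' ik' FY FY'.
    have ref := refines_unused kU'
      (refines_unused iU' (refines_refl optS) FY) FY'.
    have := @no_new_coordinate _ (valid_recast vS ref) maxS (J i, false) i' k' jA.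
    by rewrite /= upd_same (upd_other _ _ ik') upd_same.
  have [h|h] := beyond_cross bB bD.
    exact: (noF i k B D').
  by apply: (noF k i D B') => //; rewrite eq_sym.
have sub : J @: (~: used S) \subset ~: act S.
  by apply/subsetP => _ /imsetP[i + ->]; rewrite !in_setC => /JP[].
have := subset_leq_card sub; rewrite (card_in_imset inj).
have := cardsC (used S); have := cardsC (act S); rewrite card_ord cK.
have := card_used S; rewrite /rank; have := card_act S.
(* With A active coordinates, the count so far is 3d - |[used S]| <= d - A. It fails since
   |[used S]| <= 3A - 1 for A > 0, and since no colour is used and d > 0 for A = 0. *)
have [A0|[j jA]] := set_0Vmem (act S).
  by rewrite (links_nil vS A0) A0 cards0 /=; lia.
by have := size_links vS jA; lia.
Qed.

End Configurations.

Theorem theorem8 (d : nat) (hd : (0 < d)%N)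
  (F : 'I_(3 * d)%N -> box d -> Prop)
  (Fne : forall k, exists B, F k B)
  (Hcol : forall C : 'I_(3 * d)%N -> box d,
      colorful F C -> two_pierceable (tuple_family C)) :
  exists (i : 'I_(3 * d)%N) (Fk : 'I_(3 * d)%N -> box d),
    (forall k, k <> i -> F k (Fk k)) /\
    two_pierceable (fun B => F i B \/ exists2 k, k <> i & B = Fk k).
Proof.
have pierce C : (forall k, F k (C k)) -> two_pierceable (fun B => exists k, B = C k).
  by move=> FC; apply: Hcol; exists id; split=> // j k.
have n0 : (0 < 3 * d)%N by lia.
have [S optS] := optimal_exists pierce (Ordinal n0) Fne.
have [i iU Fi] := unused_color_exists pierce hd (card_ord _) optS.
have vS := valid_optimal optS.
have [s sS] := sol_nonempty pierce vS.
exists i, (tup S); split; first by case: vS.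
exact: (final_family_pierceable optS iU sS Fi).
Qed.
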